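(* Let $\mathbf{X}\in\mathcal{L}_{m,N}(q)$ and $\mathbf{Y}=\mathbf{X}^{+}$. Then $$(d\mathbf{Y})=\prod_{i=1}^{k}\sigma_i^{-2(N+m-k)}\,(d\mathbf{X}),$$ where $\mathbf{X}=\mathbf{H}_1\mathbf{D}_\sigma\mathbf{P}_1'$ is the nonsingular part of the singular value decomposition of $\mathbf{X}$, with $\mathbf{H}_1\in\mathcal{V}_{k,N}$, $\mathbf{P}_1\in\mathcal{V}_{k,m}$, $\mathbf{D}_\sigma=\operatorname{diag}(\sigma_1,\dots,\sigma_k)$, $\sigma_1>\cdots>\sigma_k>0$, the measure $(d\mathbf{X})$ is $$(d\mathbf{X})=2^{-k}\prod_{i=1}^{k}\sigma_i^{N+m-2k}\prod_{1\le i<j\le k}(\sigma_i^2-\sigma_j^2)\,(\mathbf{H}_1'd\mathbf{H}_1)\wedge(\mathbf{P}_1'd\mathbf{P}_1)\wedge(d\mathbf{D}_\sigma),$$ and $$k=\begin{cases} q, & \mathbf{X}\in\mathcal{L}_{m,N}^{+}(q);\\ l, & \mathbf{X}\in\mathcal{L}_{m,N}^{+}(q,l).\end{cases}$$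
   Context: $\mathcal{L}_{m,N}(q)$ is the set of all $N\times m$ real matrices of rank $q\le\min(N,m)$; $\mathcal{L}_{m,N}^{+}(q)$ is the subset of those with $q$ distinct (nonzero) singular values; $\mathcal{L}_{m,N}^{+}(q,l)$, $q\ge l$, is the set of rank-$q$ matrices whose nonzero singular values have multiplicity, with $l$ distinct values. In the case of multiplicity the paper's convention is that, for computing the measure, the matrix is treated as described by the coordinates $(\mathbf{H}_1,\mathbf{D}_\sigma,\mathbf{P}_1)$ with $k=l$, the number of distinct nonzero singular values, in place of the rank. $\mathbf{X}^{+}$ is the Moore–Penrose inverse. $\mathcal{V}_{k,n}$ is the Stiefel manifold of $n\times k$ real matrices $\mathbf{H}_1$ with $\mathbf{H}_1'\mathbf{H}_1=\mathbf{I}_k$; a prime denotes transpose. For $\mathbf{H}_1=(h_1,\dots,h_k)\in\mathcal{V}_{k,n}$, completed by $h_{k+1},\dots,h_n$ to an orthogonal matrix, $(\mathbf{H}_1'd\mathbf{H}_1)=\bigwedge_{i=1}^{k}\bigwedge_{j=i+1}^{n}h_j'\,dh_i$; $(\mathbf{P}_1'd\mathbf{P}_1)$ is defined in the same way. $(d\mathbf{D}_\sigma)=\bigwedge_{i=1}^{k}d\sigma_i$. $(d\mathbf{Y})$ is the measure defined by the same formula as $(d\mathbf{X})$, applied to the $m\times N$ matrix $\mathbf{Y}$ and the nonsingular part of its singular value decomposition. Exterior products of differentials are identified with the positive measures they define, and signs are ignored. *)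

(* Defs.v *)
From HB Require Import structures.
From mathcomp Require Import all_boot all_order all_algebra.
From mathcomp Require Import all_classical all_reals all_analysis.
From mathcomp Require Import measurable_realfun.

Set Implicit Arguments.
Unset Strict Implicit.
Unset Printing Implicit Defensive.

Import Order.TTheory GRing.Theory Num.Theory.
Import numFieldNormedType.Exports.

Local Open Scope classical_set_scope.
Local Open Scope ring_scope.

(* The sigma-algebra generated by the entries, as the library does for tuples.
   Over the reals it is the Borel sigma-algebra (see [open_measurable_mx]). *)

Definition mx_entry_sets d (T : measurableType d) m n : set (set 'M[T]_(m, n)) :=
  [set A | exists i j (B : set T),
     measurable B /\ A = (fun X : 'M[T]_(m, n) => X i j) @^-1` B].

Definition measure_mx_display : measure_display -> measure_display.
Proof. exact. Qed.

Section measurable_matrix.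
Context d (T : measurableType d) (m n : nat).

Let mx_set0 : <<s @mx_entry_sets d T m n >> set0.
Proof. exact: sigma_algebra0. Qed.

Let mx_setC A : <<s @mx_entry_sets d T m n >> A -> <<s @mx_entry_sets d T m n >> (~` A).
Proof. exact: sigma_algebraC. Qed.

Let mx_bigcup (F : (set 'M[T]_(m, n))^nat) :
  (forall i, <<s @mx_entry_sets d T m n >> (F i)) ->
  <<s @mx_entry_sets d T m n >> (\bigcup_i (F i)).
Proof. exact: sigma_algebra_bigcup. Qed.

HB.instance Definition _ := Pointed.on 'M[T]_(m, n).
HB.instance Definition _ := @isMeasurable.Build (measure_mx_display d)
  'M[T]_(m, n) <<s @mx_entry_sets d T m n >> mx_set0 mx_setC mx_bigcup.

Lemma measurable_entry i j :
  measurable_fun setT (fun X : 'M[T]_(m, n) => X i j).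
Proof.
move=> _ B mB; rewrite setTI; apply: sub_sigma_algebra.
by exists i, j, B.
Qed.

Lemma measurable_mxP d' (S : measurableType d') (D : set S)
    (f : S -> 'M[T]_(m, n)) : measurable D ->
  (forall i j, measurable_fun D (fun x => f x i j)) -> measurable_fun D f.
Proof.
move=> mD mf; apply: (@measurability _ _ _ _ _ _ (@mx_entry_sets d T m n)) => //.
by move=> _ [_ [i [j [B [mB ->]]]] <-]; exact: mf.
Qed.

End measurable_matrix.

Lemma open_measurable_mx (R : realType) m n (U : set 'M[R]_(m, n)) :
  open U -> measurable U.
Proof.
move=> oU.
pose box (p : 'M[rat]_(m, n) * 'M[rat]_(m, n)) : set 'M[R]_(m, n) :=
  [set X | forall i j, ratr (p.1 i j) < X i j < ratr (p.2 i j)].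
have mbox p : measurable (box p).
  have -> : box p = \bigcap_(i in setT) \bigcap_(j in setT)
     ((fun X : 'M[R]_(m, n) => X i j) @^-1`
       [set` `]ratr (p.1 i j), ratr (p.2 i j)[%R]).
    apply/seteqP; split=> [X /= bX i _ j _|X /= bX i j]; first exact: bX.
    exact: bX.
  apply: fin_bigcap_measurable => // i _; apply: fin_bigcap_measurable => // j _.
  rewrite -[X in measurable X]setTI; apply: measurable_entry => //.
have -> : U = \bigcup_p (if `[< box p `<=` U >] then box p else set0).
  apply/seteqP; split=> [X UX|X [p _]]; last first.
    by case: ifPn => // /asboolP; exact.
  have /nbhs_ballP[e e0 eU] := oU _ UX.
  have ex i j : exists ab : rat * rat,
      (ratr ab.1 < X i j < ratr ab.2) /\
      [set` `]ratr ab.1, ratr ab.2[%R] `<=` ball (X i j) e.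
    have /rat_in_itvoo[a] : X i j - e < X i j by rewrite ltrBlDr ltrDl.
    have /rat_in_itvoo[b] : X i j < X i j + e by rewrite ltrDl.
    rewrite !in_itv/= => /andP[b1 b2] /andP[a1 a2].
    exists (a, b); split => /=; first by rewrite a2 b1.
    move=> y /=; rewrite in_itv/= => /andP[y1 y2].
    rewrite /ball /= ltr_distlC (lt_trans a1)//=.
    exact: lt_trans b2.
  pose f i j := projT1 (cid (ex i j)).
  exists (\matrix_(i, j) (f i j).1, \matrix_(i, j) (f i j).2) => //.
  case: ifPn => [_|/asboolPn]; last first.
    case=> Y bY; apply: eU; split=> // i j.
    have := bY i j; rewrite !mxE => Yij.
    by apply: (projT2 (cid (ex i j))).2; rewrite /= in_itv.
  move=> i j; rewrite !mxE; exact: (projT2 (cid (ex i j))).1.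
apply: countable_bigcupT_measurable => [|p]; first exact: countableP.
by case: ifPn.
Qed.

Lemma sigma_finite_prod d1 d2 (T1 : measurableType d1) (T2 : measurableType d2)
    (R : realType) (m1 : {sigma_finite_measure set T1 -> \bar R})
    (m2 : {sigma_finite_measure set T2 -> \bar R}) :
  sigma_finite setT (m1 \x m2)%E.
Proof.
have /sigma_finiteP[F [TF ndF Foo]] := sigma_finiteT m1.
have /sigma_finiteP[G [TG ndG Goo]] := sigma_finiteT m2.
exists (fun n => F n `*` G n).
  rewrite -setXTT TF TG; apply/seteqP; split=> [[x y] [[n _ Fx] [k _ Gy]]|].
    exists (maxn n k) => //; split => /=.
    - by move: Fx; apply: (subsetPset _ _ (ndF _ _ (leq_maxl _ _))).
    - by move: Gy; apply: (subsetPset _ _ (ndG _ _ (leq_maxr _ _))).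
  by move=> [x y] [n _ [? ?]]; split; exists n.
move=> k; have [mF Fk] := Foo k; have [mG Gk] := Goo k.
split; first exact: measurableX.
by rewrite product_measure1E// lte_mul_pinfty// ge0_fin_numE.
Qed.

Section lebesgue_rV.
Context (R : realType).

Definition cons_rV n (p : R * 'rV[R]_n) : 'rV[R]_n.+1 :=
  row_mx p.1%:M p.2 : 'rV_(1 + n).

Lemma measurable_cons_rV n : measurable_fun setT (@cons_rV n).
Proof.
apply: measurable_mxP => // i j; rewrite /cons_rV.
case: (@split_ordP 1 n j) => l ->.
- apply: (eq_measurable_fun fst) => [x _|]; last exact: measurable_fst.
  by rewrite (@row_mxEl _ 1 1 n) !ord1 mxE.
- apply: (eq_measurable_fun (fun x : R * 'rV[R]_n => x.2 i l)) => [x _|].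
    by rewrite (@row_mxEr _ 1 1 n).
  exact: (measurableT_comp (measurable_entry i l) measurable_snd).
Qed.

Section step.
Variables (n : nat) (mu : {sigma_finite_measure set 'rV[R]_n -> \bar R}).

Definition lebesgue_rVS :=
  pushforward (@lebesgue_measure R \x mu)%E (@cons_rV n).

Let lebesgue_rVS0 : lebesgue_rVS set0 = 0%E.
Proof. by rewrite /lebesgue_rVS/pushforward preimage_set0 measure0. Qed.

Let lebesgue_rVS_ge0 A : (0 <= lebesgue_rVS A)%E.
Proof. by rewrite /lebesgue_rVS /pushforward measure_ge0. Qed.

Let preim_cons A : measurable A -> measurable (@cons_rV n @^-1` A).
Proof. by move=> mA; rewrite -[X in measurable X]setTI; exact: measurable_cons_rV. Qed.

Let lebesgue_rVS_sigma_additive : semi_sigma_additive lebesgue_rVS.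
Proof.
move=> F mF tF mUF; rewrite /lebesgue_rVS /pushforward preimage_bigcup.
apply: measure_semi_sigma_additive.
- by move=> i; exact: preim_cons.
- apply/trivIsetP => i j _ _ ij; rewrite -preimage_setI.
  by move/trivIsetP : tF => /(_ _ _ _ _ ij) ->//; rewrite preimage_set0.
- by rewrite -preimage_bigcup; exact: preim_cons.
Qed.

HB.instance Definition _ := isMeasure.Build _ _ _ lebesgue_rVS
  lebesgue_rVS0 lebesgue_rVS_ge0 lebesgue_rVS_sigma_additive.

Let lebesgue_rVS_sigma_finite : sigma_finite setT lebesgue_rVS.
Proof.
pose uncons (v : 'rV[R]_n.+1) : R * 'rV[R]_n :=
  (v ord0 ord0, \row_j v ord0 (lift ord0 j)).
have consK : cancel (@cons_rV n) uncons.
  case=> x v; rewrite /uncons /cons_rV /=; congr pair.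
    have -> : ord0 = lshift n (@ord0 0) by exact/val_inj.
    by rewrite (@row_mxEl _ 1 1 n) mxE.
  apply/rowP => j; rewrite mxE.
  have -> : lift ord0 j = rshift 1 j by exact/val_inj.
  by rewrite (@row_mxEr _ 1 1 n).
have muncons : measurable_fun setT uncons.
  apply/measurable_fun_pair; first exact: measurable_entry.
  apply: measurable_mxP => // i j.
  apply: (eq_measurable_fun (fun v : 'rV[R]_n.+1 => v ord0 (lift ord0 j))).
    by move=> v _; rewrite mxE.
  exact: measurable_entry.
have [F TF Ffin] : sigma_finite setT (@lebesgue_measure R \x mu)%E.
  exact: sigma_finite_prod.
exists (fun i => uncons @^-1` F i).
  by rewrite -preimage_bigcup -TF preimage_setT.
move=> i; have [mF Foo] := Ffin i; split.
  by rewrite -[X in measurable X]setTI; exact: muncons.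
rewrite /lebesgue_rVS /pushforward -comp_preimage.
by rewrite (_ : uncons \o _ = id)//; apply/funext => p /=; rewrite consK.
Qed.

HB.instance Definition _ := Measure_isSigmaFinite.Build _ _ _ lebesgue_rVS
  lebesgue_rVS_sigma_finite.

End step.

(* the product of n copies of [lebesgue_measure] *)
Fixpoint lebesgue_rV n : {sigma_finite_measure set 'rV[R]_n -> \bar R} :=
  match n with
  | 0 => \d_(0 : 'rV[R]_0)
  | n'.+1 => lebesgue_rVS (lebesgue_rV n')
  end.

End lebesgue_rV.

(* points (H1, (sigma_1, ..., sigma_k), P1) *)
Notation svd_coord R N m k :=
  ('M[R]_(N, k) * 'rV[R]_k * 'M[R]_(m, k))%type.

Section matrices.
Context (R : realType).

Definition nz_singular_values N m (X : 'M[R]_(N, m)) : set R :=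
  [set s | 0 < s /\ eigenvalue (X^T *m X) (s ^+ 2)].

Definition rank_set N m q : set 'M[R]_(N, m) := [set X | \rank X = q].

Definition rank_simple_set N m q : set 'M[R]_(N, m) :=
  [set X | rank_set q X /\ (nz_singular_values X #= `I_q)%card].

Definition rank_mult_set N m q l : set 'M[R]_(N, m) :=
  [set X | rank_set q X /\ (nz_singular_values X #= `I_l)%card].

Definition is_mpinv N m (X : 'M[R]_(N, m)) (Y : 'M[R]_(m, N)) : Prop :=
  [/\ X *m Y *m X = X, Y *m X *m Y = Y,
      (X *m Y)^T = X *m Y & (Y *m X)^T = Y *m X].

Definition mpinv N m (X : 'M[R]_(N, m)) : 'M[R]_(m, N) := get (is_mpinv X).

Definition svd_H N m k (c : svd_coord R N m k) : 'M[R]_(N, k) := c.1.1.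
Definition svd_sigma N m k (c : svd_coord R N m k) : 'rV[R]_k := c.1.2.
Definition svd_P N m k (c : svd_coord R N m k) : 'M[R]_(m, k) := c.2.

Definition svd_space N m k : set (svd_coord R N m k) :=
  [set c : svd_coord R N m k | [/\ (svd_H c)^T *m svd_H c = 1%:M,
    (svd_P c)^T *m svd_P c = 1%:M, (forall i, 0 < svd_sigma c ord0 i) &
    (forall i j : 'I_k, (i < j)%N -> svd_sigma c ord0 j < svd_sigma c ord0 i)]].

Definition svd_mx N m k (c : svd_coord R N m k) : 'M[R]_(N, m) :=
  svd_H c *m diag_mx (svd_sigma c) *m (svd_P c)^T.

Definition is_thin_svd N m q (X : 'M[R]_(N, m)) (c : svd_coord R N m q) : Prop :=
  [/\ (svd_H c)^T *m svd_H c = 1%:M, (svd_P c)^T *m svd_P c = 1%:M,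
    (forall i, 0 < svd_sigma c ord0 i),
    (forall i j : 'I_q, (i <= j)%N -> svd_sigma c ord0 j <= svd_sigma c ord0 i) &
    X = svd_mx c].

(* [c] describes the rank-[q] matrix [X]: one singular triple of a singular
   value decomposition of [X] is kept for each distinct nonzero singular value.
   If the nonzero singular values are distinct, [k = q] and [X = svd_mx c]. *)
Definition describes N m q k (X : 'M[R]_(N, m)) (c : svd_coord R N m k) : Prop :=
  svd_space c /\
  exists (b : svd_coord R N m q) (f : 'I_k -> 'I_q),
    [/\ is_thin_svd X b,
        c = (colsub f (svd_H b), colsub f (svd_sigma b), colsub f (svd_P b)) &
        forall i, exists a, svd_sigma b ord0 i = svd_sigma b ord0 (f a)].

(* The coordinates of the Moore-Penrose inverse P1 D^-1 H1' of H1 D P1': the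
   order is reversed since 1/sigma_k > ... > 1/sigma_1 *)
Definition mpinv_coord N m k (c : svd_coord R N m k) : svd_coord R m N k :=
  (colsub (@rev_ord k) (svd_P c), \row_i (svd_sigma c ord0 (rev_ord i))^-1,
   colsub (@rev_ord k) (svd_H c)).

(* (i, j) with i < k, i < j < n: the index of the 1-form h_j' dh_i *)
Definition stiefel_idx n k := {p : 'I_k * 'I_n | (p.1 < p.2)%N}.

(* the 1-forms in (H1'dH1) /\ (P1'dP1) /\ (dD) *)
Definition form_idx N m k : Type :=
  (stiefel_idx N k + stiefel_idx m k + 'I_k)%type.
HB.instance Definition _ N m k := Finite.on (form_idx N m k).

Definition svd_dim N m k := #|{: form_idx N m k}|.

(* Q = (h_1, ..., h_n) is an orthogonal matrix completing H = (h_1, ..., h_k) *)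
Definition completes n k (H : 'M[R]_(n, k)) (Q : 'M[R]_n) : Prop :=
  Q^T *m Q = 1%:M /\
  forall i (a : 'I_k) (b : 'I_n), a = b :> nat -> Q i b = H i a.

(* values on the tangent vector [t] of the 1-forms, completed by [Q1], [Q2] *)
Definition coframe N m k (Q1 : 'M[R]_N) (Q2 : 'M[R]_m) (t : svd_coord R N m k)
    (w : form_idx N m k) : R :=
  match w with
  | inl (inl p) => (Q1^T *m svd_H t) (val p).2 (val p).1
  | inl (inr p) => (Q2^T *m svd_P t) (val p).2 (val p).1
  | inr i => svd_sigma t ord0 i
  end.

Definition svd_weight N m k (s : 'rV[R]_k) : R :=
  2 ^- k * \prod_(i < k) s ord0 i ^+ (N + m - 2 * k) *
  \prod_(i < k) \prod_(j < k | (i < j)%N) (s ord0 i ^+ 2 - s ord0 j ^+ 2).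

Section chart.
Context (N m k : nat).
Let d := svd_dim N m k.

(* A parametrization of an open part of [svd_space] by an open set of R^d, with
   the completions of H1 and P1 chosen continuously. Another choice of
   completions only changes the sign of the form. *)
Record svd_chart := SvdChart {
  chart_dom : set 'rV[R]_d ;
  chart_map : 'rV[R]_d -> svd_coord R N m k ;
  chart_Q1 : 'rV[R]_d -> 'M[R]_N ;
  chart_Q2 : 'rV[R]_d -> 'M[R]_m }.

Definition C1_on a b (U : set 'rV[R]_d) (f : 'rV[R]_d -> 'M[R]_(a, b)) : Prop :=
  forall u, U u -> {for u, continuous f} /\
    forall i : 'I_d, derivable f u 'e_i /\ {for u, continuous ('D_'e_i f)}.

Definition partial_coord (phi : 'rV[R]_d -> svd_coord R N m k) (i : 'I_d) u :
    svd_coord R N m k :=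
  ('D_'e_i (fun v => svd_H (phi v)) u, 'D_'e_i (fun v => svd_sigma (phi v)) u,
   'D_'e_i (fun v => svd_P (phi v)) u).

(* the pullback of (H1'dH1) /\ (P1'dP1) /\ (dD) is [form_pullback C] du *)
Definition form_pullback (C : svd_chart) (u : 'rV[R]_d) : R :=
  \det (\matrix_(a < d, b < d)
    coframe (chart_Q1 C u) (chart_Q2 C u) (partial_coord (chart_map C) b u)
            (enum_val a)).

Definition is_svd_chart (C : svd_chart) : Prop :=
  let U := chart_dom C in let phi := chart_map C in
  [/\ open U,
      (forall u, U u -> [/\ svd_space (phi u),
         completes (svd_H (phi u)) (chart_Q1 C u) &
         completes (svd_P (phi u)) (chart_Q2 C u)]),
      (forall u v, U u -> U v -> phi u = phi v -> u = v),
      [/\ C1_on U (fun u => svd_H (phi u)), C1_on U (fun u => svd_sigma (phi u)) &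
          C1_on U (fun u => svd_P (phi u))] &
      forall u, U u -> [/\ {for u, continuous (chart_Q1 C)},
         {for u, continuous (chart_Q2 C)} & form_pullback C u != 0]].

Definition chart_density (C : svd_chart) (u : 'rV[R]_d) : R :=
  `| svd_weight N m (svd_sigma (chart_map C u)) * form_pullback C u |.

Local Open Scope ereal_scope.

(* the measure of the part of [A] in [svd_space] if one chart contains that
   part, [+oo] otherwise *)
Definition svd_premeasure (A : set (svd_coord R N m k)) : \bar R :=
  ereal_inf [set x | exists C : svd_chart, [/\ is_svd_chart C,
    A `&` @svd_space N m k `<=` chart_map C @` chart_dom C &
    x = \int[lebesgue_rV R d]_(u in chart_dom C `&` chart_map C @^-1` A)
          (chart_density C u)%:E]].

(* The measure on [svd_space] defined by the form
   2^-k prod_i sigma_i^(N+m-2k) prod_(i<j) (sigma_i^2 - sigma_j^2)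
     (H1'dH1) /\ (P1'dP1) /\ (dD),
   extended by countable covers, as charts cover [svd_space] only locally. The
   factor 2^-k makes (dX) its image under the 2^k-to-one map [svd_mx]. *)
Definition svd_measure : set (svd_coord R N m k) -> \bar R :=
  mu_ext svd_premeasure.

Lemma svd_premeasure_ge0 A : 0 <= svd_premeasure A.
Proof.
apply: le_ereal_inf_tmp => _ [C [_ _ ->]]; apply: integral_ge0 => u _.
by rewrite lee_fin normr_ge0.
Qed.

Lemma svd_premeasure0 : svd_premeasure set0 = 0.
Proof.
apply/eqP; rewrite eq_le svd_premeasure_ge0 andbT; apply: ereal_inf_lbound.
exists (SvdChart set0 (fun=> point) (fun=> point) (fun=> point)).
split; [|by rewrite set0I; exact: sub0set|by rewrite set0I integral_set0].
by split; [exact: open0|move=> ? []|move=> ? ? []|split=> ? []|move=> ? []].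
Qed.

Lemma continuous_measurable_rV (U : set 'rV[R]_d) (f : 'rV[R]_d -> R) :
  open U -> (forall u, U u -> {for u, continuous f}) -> measurable_fun U f.
Proof.
move=> oU cf; apply: (measurability _ (RGenOpens.measurableE R)).
move=> _ [_ [a [b ->] <-]]; apply: open_measurable_mx.
rewrite openE => u /= [Uu abfu]; rewrite /interior.
apply: filterI; first exact: open_nbhs_nbhs.
apply: cf => //; apply: open_nbhs_nbhs; split => //; exact: interval_open.
Qed.

Lemma continuous_measurable_mx a b (U : set 'rV[R]_d)
    (f : 'rV[R]_d -> 'M[R]_(a, b)) :
  open U -> (forall u, U u -> {for u, continuous f}) -> measurable_fun U f.
Proof.
move=> oU cf; apply: measurable_mxP; first exact: open_measurable_mx.
move=> i j; apply: continuous_measurable_rV => // u Uu.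
apply: (@continuous_comp _ _ _ f (fun X : 'M[R]_(a, b) => X i j) u (cf u Uu)).
exact: coord_continuous.
Qed.

Lemma measurable_mulmx d' (S : measurableType d') (D : set S) a b c
    (f : S -> 'M[R]_(a, b)) (g : S -> 'M[R]_(b, c)) :
  measurable D -> measurable_fun D f -> measurable_fun D g ->
  measurable_fun D (fun x => f x *m g x).
Proof.
move=> mD mf mg; apply: measurable_mxP => // i j.
apply: (eq_measurable_fun (fun x => \sum_l f x i l * g x l j)%R) => [x _|].
  by rewrite mxE.
apply: measurable_sum => l; apply: measurable_funM.
- exact: (measurableT_comp (measurable_entry i l) mf).
- exact: (measurableT_comp (measurable_entry l j) mg).
Qed.

Lemma measurable_trmx d' (S : measurableType d') (D : set S) a b
    (f : S -> 'M[R]_(a, b)) :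
  measurable D -> measurable_fun D f -> measurable_fun D (fun x => (f x)^T).
Proof.
move=> mD mf; apply: measurable_mxP => // i j.
apply: (eq_measurable_fun (fun x => f x j i)) => [x _|]; first by rewrite mxE.
exact: (measurableT_comp (measurable_entry j i) mf).
Qed.

Lemma measurable_pairD d0 d1 d2 (S : measurableType d0)
    (T1 : measurableType d1) (T2 : measurableType d2) (D : set S)
    (f : S -> T1) (g : S -> T2) : measurable_fun D f -> measurable_fun D g ->
  measurable_fun D (fun x => (f x, g x)).
Proof.
move=> mf mg mD; apply: (measurability
  (preimage_set_system setT fst measurable `|`
   preimage_set_system setT snd measurable)) => //.
by move=> _ [_ [[A mA <-]|[A mA <-]] <-]; rewrite setTI; [exact: mf|exact: mg].
Qed.

Lemma measurable_chart_map C : is_svd_chart C ->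
  measurable_fun (chart_dom C) (chart_map C).
Proof.
move=> [oU _ _ [cH cD cP] _].
apply: (eq_measurable_fun (fun u => (svd_H (chart_map C u),
    svd_sigma (chart_map C u), svd_P (chart_map C u)))) => [u _|].
  by case: (chart_map C u) => -[].
have mH : measurable_fun (chart_dom C) (fun u => svd_H (chart_map C u)).
  by apply: (continuous_measurable_mx oU) => u /cH[].
have mD : measurable_fun (chart_dom C) (fun u => svd_sigma (chart_map C u)).
  by apply: (continuous_measurable_mx oU) => u /cD[].
have mP : measurable_fun (chart_dom C) (fun u => svd_P (chart_map C u)).
  by apply: (continuous_measurable_mx oU) => u /cP[].
exact: measurable_pairD (measurable_pairD mH mD) mP.
Qed.

Lemma measurable_chart_density C : is_svd_chart C ->
  measurable_fun (chart_dom C) (chart_density C).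
Proof.
move=> [oU _ _ [cH cD cP] cQ].
have mU := open_measurable_mx oU.
have mentry a b (f : 'rV[R]_d -> 'M[R]_(a, b)) i j :
    measurable_fun (chart_dom C) f ->
    measurable_fun (chart_dom C) (fun u => f u i j).
  exact: (measurableT_comp (measurable_entry i j)).
have mD : measurable_fun (chart_dom C) (fun u => svd_sigma (chart_map C u)).
  by apply: (continuous_measurable_mx oU) => u /cD[].
have mdH b :
    measurable_fun (chart_dom C) ('D_'e_b (fun u => svd_H (chart_map C u))).
  by apply: (continuous_measurable_mx oU) => u /cH[_ /(_ b)[]].
have mdD b :
    measurable_fun (chart_dom C) ('D_'e_b (fun u => svd_sigma (chart_map C u))).
  by apply: (continuous_measurable_mx oU) => u /cD[_ /(_ b)[]].
have mdP b :
    measurable_fun (chart_dom C) ('D_'e_b (fun u => svd_P (chart_map C u))).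
  by apply: (continuous_measurable_mx oU) => u /cP[_ /(_ b)[]].
rewrite /chart_density; apply: measurableT_comp => //.
apply: measurable_funM; rewrite /svd_weight.
  apply: measurable_funM; first apply: measurable_funM => //.
    by apply: measurable_prod => i _; apply: measurable_funX; exact: mentry.
  apply: measurable_prod => i _.
  under eq_fun do rewrite big_mkcond.
  apply: measurable_prod => j _; case: (i < j)%N; last exact: measurable_cst.
  by apply: measurable_funB; apply: measurable_funX; exact: mentry.
rewrite /form_pullback /determinant.
apply: measurable_sum => s; apply: measurable_funM => //.
apply: measurable_prod => b _.
under eq_fun do rewrite mxE.
rewrite /coframe; case: (enum_val b) => [[p|p]|i].
- apply: (mentry _ _ (fun u => (chart_Q1 C u)^T *m _)).
  apply: measurable_mulmx => //.
    by apply: measurable_trmx => //; apply: (continuous_measurable_mx oU) => u /cQ[].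
  exact: mdH.
- apply: (mentry _ _ (fun u => (chart_Q2 C u)^T *m _)).
  apply: measurable_mulmx => //.
    by apply: measurable_trmx => //; apply: (continuous_measurable_mx oU) => u /cQ[].
  exact: mdP.
- apply: mentry.
  exact: mdD.
Qed.

Lemma svd_premeasure_split A E : measurable A -> measurable E ->
  svd_premeasure (A `&` E) + svd_premeasure (A `&` ~` E) <= svd_premeasure A.
Proof.
move=> mA mE; apply: le_ereal_inf_tmp => _ [C [hC AC ->]].
have mC := measurable_chart_map hC.
have mU : measurable (chart_dom C) by apply: open_measurable_mx; case: hC.
have mpre B : measurable B -> measurable (chart_dom C `&` chart_map C @^-1` B).
  exact: mC.
set U := chart_dom C in mC mU mpre *.
have -> : U `&` chart_map C @^-1` A =
    (U `&` chart_map C @^-1` (A `&` E)) `|` (U `&` chart_map C @^-1` (A `&` ~` E)).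
  by rewrite -setIUr -preimage_setU -setIUr setUv setIT.
rewrite ge0_integral_setU; last 5 first.
- by apply: mpre; apply: measurableI.
- by apply: mpre; apply: measurableI => //; exact: measurableC.
- apply/measurable_EFinP; apply: measurable_funS (measurable_chart_density hC) => //.
  by rewrite -setIUr; exact: subIsetl.
- by move=> u _; rewrite lee_fin normr_ge0.
- by apply/disj_setPS => u [[_ [_ Eu]] [_ [_]]].
apply: leeD; apply: ereal_inf_lbound; exists C; split => //;
  by apply: subset_trans AC; apply: setSI; exact: subIsetl.
Qed.

HB.instance Definition _ := isOuterMeasure.Build R _ svd_measure
  (mu_ext0 svd_premeasure0 svd_premeasure_ge0)
  (mu_ext_ge0 svd_premeasure_ge0)
  (@le_mu_ext _ _ _ svd_premeasure)
  (mu_ext_sigma_subadditive svd_premeasure_ge0).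

Lemma svd_measure_caratheodory E : measurable E -> svd_measure.-caratheodory E.
Proof.
move=> mE; apply: le_caratheodory_measurable => X.
apply: le_ereal_inf_tmp => _ [A [mA XA] <-].
apply: (@le_trans _ _ (\sum_(n <oo) svd_premeasure (A n `&` E) +
                       \sum_(n <oo) svd_premeasure (A n `&` ~` E))).
  apply: leeD; apply: ereal_inf_lbound.
  - exists (fun n => A n `&` E) => //; split=> [n|]; first exact: measurableI.
    by rewrite -setI_bigcupl; exact: setSI.
  - exists (fun n => A n `&` ~` E) => //; split=> [n|].
      by apply: measurableI => //; exact: measurableC.
    by rewrite -setI_bigcupl; exact: setSI.
rewrite -nneseriesD; [|by move=> *; exact: svd_premeasure_ge0..].
apply: lee_nneseries => n *; first by rewrite adde_ge0 ?svd_premeasure_ge0.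
exact: svd_premeasure_split.
Qed.

Let svd_measure_sigma_additive : semi_sigma_additive svd_measure.
Proof.
move=> F mF tF mUF.
by apply: (@caratheodory_measure_sigma_additive _ _ svd_measure) => // [n|];
  exact: svd_measure_caratheodory.
Qed.

HB.instance Definition _ := isMeasure.Build _ _ _ svd_measure
  (outer_measure0 svd_measure) (outer_measure_ge0 svd_measure)
  svd_measure_sigma_additive.

End chart.
End matrices.

(* Main.v *)
Require Import Defs.
From HB Require Import structures.
From mathcomp Require Import all_boot all_order all_algebra.
From mathcomp Require Import all_classical all_reals all_analysis.
From mathcomp Require Import perm measurable_realfun zify ring.

Set Implicit Arguments.
Unset Strict Implicit.
Unset Printing Implicit Defensive.

Import Order.TTheory GRing.Theory Num.Theory.
Import numFieldNormedType.Exports.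

Local Open Scope classical_set_scope.
Local Open Scope ring_scope.

(** In the coordinates [(H1, sigma, P1)] the Moore-Penrose inverse is the involution
    [mpinv_coord], which sends [sigma_i] to [1 / sigma_i], exchanges [H1] and [P1],
    and reverses the order of the columns. The theorem is the transformation rule of
    the form [2^-k prod sigma_i^(N+m-2k) prod (sigma_i^2 - sigma_j^2) (H1'dH1)
    (P1'dP1) (dD)] under this involution, up to sign:
    - reversing the columns only permutes the Stiefel forms and changes some signs: it
      puts the indices of [h_j' dh_i] in the wrong order if [j <= k], but
      [h_j' dh_i = - h_i' dh_j] in that case because [H1'H1 = 1] ([coframe_mpinv]);
    - [d(1 / sigma_i) = - sigma_i^-2 d sigma_i] and
      [1 / sigma_j^2 - 1 / sigma_i^2 = (sigma_i^2 - sigma_j^2) / (sigma_i sigma_j)^2],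
      so the factors contribute, for each [i], the exponent
      [- 2 (N+m-2k) - 2 (k-1) - 2 = - 2 (N+m-k)] ([svd_weight_mpinv]).

    Composing a chart with [mpinv_coord] therefore gives a chart whose density is that
    of the original chart times [prod sigma_i^(-2(N+m-k))] ([is_svd_chart_mpinv],
    [chart_density_mpinv]).

    The measure is an infimum over countable covers by images of charts. To pass from
    charts to the measure without comparing charts with each other (which would need
    the change of variables formula in several dimensions), only inequalities are
    transported: if the factor is at most [b] on [B], then the measure of the inverses
    of the points of [B] is at most [b] times the measure of [B]
    ([svd_measure_mpinv_le]). The same inequality for the inverse involution is a lower
    bound, and a measure that satisfies both has the factor as its density with respect
    to the other one ([density_of_bounds]): on the slice where the factor is between
    [r^(z+1)] and [r^z] the two sides agree up to a factor [r], and [r] is arbitrarily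
    close to 1. *)

(** * A density criterion for measures *)

Lemma eq_of_scale_le (R : realType) (x y : \bar R) : (0 <= x)%E -> (0 <= y)%E ->
  (forall r : R, 0 < r < 1 -> (r%:E * x <= y)%E /\ (r%:E * y <= x)%E) -> x = y.
Proof.
move=> x0 y0 xy; apply/eqP; rewrite eq_le; apply/andP.
by split; apply/lee_mul01Pr => // r /xy[].
Qed.

(** The slices [expR (z * e) <= f < expR ((z + 1) * e)], where [z : int] and
    [e = - ln r], are indexed by [nat] through [pickle]. On each of them both [nu] and
    the integral lie between [a mu] and [(a / r) mu] for one [a], and this survives
    summation whether or not [mu] is sigma-finite. *)
Lemma density_of_bounds d (T : measurableType d) (R : realType)
    (mu nu : {measure set T -> \bar R}) (D : set T) (f : T -> R) :
  measurable D -> measurable_fun D f -> (forall x, D x -> 0 < f x) ->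
  (forall B b, measurable B -> B `<=` D -> 0 < b ->
    (forall x, B x -> f x <= b) -> (nu B <= b%:E * mu B)%E) ->
  (forall B a, measurable B -> B `<=` D -> 0 < a ->
    (forall x, B x -> a <= f x) -> (a%:E * mu B <= nu B)%E) ->
  nu D = (\int[mu]_(x in D) (f x)%:E)%E.
Proof.
move=> mD mf f0 up lo.
have mfE : measurable_fun D (EFin \o f) by exact/measurable_EFinP.
apply: eq_of_scale_le => [||r r01].
- exact: measure_ge0.
- by apply: integral_ge0 => x /f0 fx; rewrite lee_fin ltW.
have /andP[r0 r1] := r01.
have e0 : 0 < - ln r by rewrite oppr_gt0 ln_lt0.
set e := - ln r in e0 *.
have er : expR (- e) = r by rewrite opprK lnK// posrE.
pose z x := Num.floor (ln (f x) / e).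
pose F n := D `&` [set x | pickle (z x) = n].
have mF n : measurable (F n).
  case E : (unpickle n : option int) => [i|]; last first.
    rewrite (_ : F n = set0)//; apply/seteqP; split=> // x [_ /= zn].
    by move: E; rewrite -zn pickleK.
  have mg : measurable_fun D (fun x => ln (f x) / e).
    apply: measurable_funM => //.
    exact: (measurableT_comp (@measurable_ln R) mf).
  rewrite (_ : F n = D `&` (fun x => ln (f x) / e) @^-1`
      [set` (if pickle i == n then `[i%:~R, (i + 1)%:~R[ else `]0, 0[)%R]); last first.
    rewrite /F; congr (_ `&` _); apply/seteqP; split=> x /=.
      move=> zn; have -> : i = z x by move: E; rewrite -zn pickleK => -[].
      by rewrite zn eqxx in_itv/= /z floor_itv.
    case: eqP => [<-|_]; rewrite in_itv/=; last by move=> /andP[/lt_trans h /h]; rewrite ltxx.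
    by move=> h; rewrite /z (floor_def h).
  exact: mg.
have DF : D = \bigcup_n F n.
  by apply/seteqP; split=> x; [move=> Dx; exists (pickle (z x))|case=> n _ []].
have tF : trivIset setT F by apply/trivIsetP=> i j _ _ /eqP ij; apply/seteqP;
  split=> // x [[_ /= xi] [_ /= xj]]; apply: ij; rewrite -xi -xj.
have FD n : F n `<=` D by move=> x [].
have bnd n : exists2 a, 0 < a & forall x, F n x -> a <= f x <= r^-1 * a.
  have [->|/set0P[y [Dy yn]]] := eqVneq (F n) set0; first by exists 1.
  exists (expR ((z y)%:~R * e)); first exact: expR_gt0.
  move=> x [Dx xn]; have fx := f0 _ Dx.
  have -> : z y = z x by apply: (pcan_inj pickleK); rewrite xn yn.
  have /andP[] := floor_itv (ln (f x) / e); rewrite -/(z x).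
  rewrite ler_pdivlMr// ltr_pdivrMr// intrD mulrDl mul1r => l1 l2.
  rewrite -[X in _ <= X <= _](lnK (x := f x)) ?posrE// ler_expR l1 /=.
  by rewrite -er -expRN opprK -expRD ler_expR addrC ltW.
have IF n : measurable_fun (F n) (EFin \o f) by exact: measurable_funS mfE.
have slice n : (r%:E * nu (F n) <= \int[mu]_(x in F n) (f x)%:E)%E /\
    (r%:E * (\int[mu]_(x in F n) (f x)%:E) <= nu (F n))%E.
  have [a a0 ha] := bnd n; split.
    apply: (@le_trans _ _ (\int[mu]_(x in F n) (cst a%:E) x)%E); last first.
      apply: ge0_le_integral => //.
      - by move=> x _; rewrite lee_fin ltW.
      - by move=> x /ha /andP[ax _]; rewrite lee_fin.
    rewrite integral_cst// -lee_pdivlMl// muleA -EFinM.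
    apply: up => //; first by rewrite mulr_gt0 ?invr_gt0.
    by move=> x /ha /andP[].
  apply: (@le_trans _ _ (a%:E * mu (F n))%E); last first.
    by apply: lo => // x /ha /andP[].
  rewrite -lee_pdivlMl// muleA -EFinM -[leRHS](integral_cst mu)//.
  apply: ge0_le_integral => //.
  - by move=> x /FD /f0 fx; rewrite lee_fin ltW.
  - by move=> x /ha /andP[_ ax]; rewrite lee_fin.
have nuE : nu D = (\sum_(n <oo) nu (F n))%E.
  by rewrite {1}DF measure_bigcup//; apply: eq_eseriesl => n; rewrite in_setT.
have intE : (\int[mu]_(x in D) (f x)%:E = \sum_(n <oo) \int[mu]_(x in F n) (f x)%:E)%E.
  rewrite {1}DF ge0_integral_bigcup//; first by rewrite -DF.
  by rewrite -DF => x /f0 fx; rewrite lee_fin ltW.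
have I0 n : (0 <= \int[mu]_(x in F n) (f x)%:E)%E.
  by apply: integral_ge0 => x /FD /f0 fx; rewrite lee_fin ltW.
rewrite nuE intE -!nneseriesZl//; split; apply: lee_nneseries => n *.
- by rewrite mule_ge0// lee_fin ltW.
- exact: (slice n).1.
- by rewrite mule_ge0// lee_fin ltW.
- exact: (slice n).2.
Qed.

(** * The Moore-Penrose inverse in singular value coordinates *)

Section moore_penrose.
Context (R : realType).

Lemma mpinv_uniq N m (X : 'M[R]_(N, m)) (Y Z : 'M[R]_(m, N)) :
  is_mpinv X Y -> is_mpinv X Z -> Y = Z.
Proof.
move=> [XYX YXY sXY sYX] [XZX ZXZ sXZ sZX].
have XYZ : X *m Y = X *m Z.
  by rewrite -sXY -{1}XZX -(mulmxA (X *m Z)) trmx_mul sXY sXZ mulmxA XYX.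
have YZX : Y *m X = Z *m X.
  by rewrite -sYX -{1}XZX -(mulmxA X) mulmxA trmx_mul sYX sZX -!mulmxA
    (mulmxA X) XYX.
by rewrite -YXY -mulmxA XYZ mulmxA YZX ZXZ.
Qed.

Lemma mpinvE N m (X : 'M[R]_(N, m)) (Y : 'M[R]_(m, N)) :
  is_mpinv X Y -> mpinv X = Y.
Proof.
move=> XY; apply: (mpinv_uniq _ XY).
by rewrite /mpinv; apply: (getPex (P := is_mpinv X)); exists Y.
Qed.

Lemma svd_mxE N m k (c : svd_coord R N m k) i j :
  svd_mx c i j = \sum_l svd_H c i l * svd_sigma c ord0 l * svd_P c j l.
Proof.
rewrite /svd_mx mul_mx_diag mxE; apply: eq_bigr => l _.
by rewrite !mxE.
Qed.

(** The columns of both factors are reversed together, which leaves the product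
    unchanged. *)
Lemma svd_mx_mpinv_coord N m k (c : svd_coord R N m k) :
  svd_mx (mpinv_coord c) =
  svd_P c *m diag_mx (\row_i (svd_sigma c ord0 i)^-1) *m (svd_H c)^T.
Proof.
apply/matrixP => i j.
have -> : svd_P c *m diag_mx (\row_i (svd_sigma c ord0 i)^-1) *m (svd_H c)^T =
  svd_mx ((svd_P c, \row_i (svd_sigma c ord0 i)^-1, svd_H c) : svd_coord R m N k).
  reflexivity.
rewrite !svd_mxE (reindex_inj rev_ord_inj) /=.
by apply: eq_bigr => l _; rewrite !mxE rev_ordK.
Qed.

Lemma mpinv_svd_mx N m k (c : svd_coord R N m k) :
  (svd_H c)^T *m svd_H c = 1%:M -> (svd_P c)^T *m svd_P c = 1%:M ->
  (forall i, 0 < svd_sigma c ord0 i) ->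
  mpinv (svd_mx c) = svd_mx (mpinv_coord c).
Proof.
move=> HH PP s0; apply: mpinvE; rewrite svd_mx_mpinv_coord /svd_mx.
set H := svd_H c in HH *; set P := svd_P c in PP *; set s := svd_sigma c in s0 *.
set S := diag_mx s; set T := diag_mx _.
have ST : S *m T = 1%:M.
  rewrite mulmx_diag -diag_const_mx; congr diag_mx.
  by apply/rowP => i; rewrite !mxE mulfV// gt_eqF.
have TS : T *m S = 1%:M by rewrite diag_mxC.
have E1 : H *m S *m P^T *m (P *m T *m H^T) = H *m H^T.
  by rewrite -!mulmxA (mulmxA P^T) PP mul1mx (mulmxA S) ST mul1mx.
have E2 : P *m T *m H^T *m (H *m S *m P^T) = P *m P^T.
  by rewrite -!mulmxA (mulmxA H^T) HH mul1mx (mulmxA T) TS mul1mx.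
split.
- by rewrite E1 -!mulmxA (mulmxA H^T) HH mul1mx.
- by rewrite E2 -!mulmxA (mulmxA P^T) PP mul1mx.
- by rewrite E1 trmx_mul trmxK.
- by rewrite E2 trmx_mul trmxK.
Qed.

Lemma mpinv_coordK N m k : cancel (@mpinv_coord R N m k) (@mpinv_coord R m N k).
Proof.
move=> [[H s] P]; rewrite /mpinv_coord /svd_P /svd_H /svd_sigma /=.
congr (_, _, _); apply/matrixP => i j; rewrite !mxE rev_ordK//.
by rewrite invrK (ord1 i).
Qed.

Lemma orthonormal_colsub n k l (f : 'I_l -> 'I_k) (H : 'M[R]_(n, k)) :
  injective f -> H^T *m H = 1%:M -> (colsub f H)^T *m colsub f H = 1%:M.
Proof.
move=> fI HH; apply/matrixP => i j.
transitivity ((H^T *m H) (f i) (f j)).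
  by rewrite !mxE; apply: eq_bigr => l' _; rewrite !mxE.
by rewrite HH !mxE (inj_eq fI).
Qed.

Lemma ltn_rev k (i j : 'I_k) : (rev_ord i < rev_ord j)%N = (j < i)%N.
Proof. by rewrite /= ltn_sub2lE ?ltnS. Qed.

Lemma leq_rev k (i j : 'I_k) : (rev_ord i <= rev_ord j)%N = (j <= i)%N.
Proof. by rewrite leqNgt ltn_rev -leqNgt. Qed.

Lemma svd_space_mpinv_coord N m k (c : svd_coord R N m k) :
  svd_space c -> svd_space (mpinv_coord c).
Proof.
move=> [HH PP s0 sd].
split=> [||i|i j ij].
- exact: orthonormal_colsub rev_ord_inj PP.
- exact: orthonormal_colsub rev_ord_inj HH.
- by rewrite /svd_sigma mxE invr_gt0 s0.
- by rewrite /svd_sigma !mxE ltf_pV2 ?posrE ?s0// sd// ltn_rev.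
Qed.

Lemma describes_mpinv N m q k (X : 'M[R]_(N, m)) (c : svd_coord R N m k) :
  describes q X c -> describes q (mpinv X) (mpinv_coord c).
Proof.
move=> [cS [b [f [[HH PP s0 sd Xb] cb fs]]]]; split.
  exact: svd_space_mpinv_coord.
exists (mpinv_coord b), (@rev_ord q \o f \o @rev_ord k); split.
- split.
  + exact: orthonormal_colsub rev_ord_inj PP.
  + exact: orthonormal_colsub rev_ord_inj HH.
  + by move=> i; rewrite /svd_sigma mxE invr_gt0 s0.
  + by move=> i j ij; rewrite /svd_sigma !mxE lef_pV2 ?posrE ?s0// sd// leq_rev.
  + by rewrite Xb mpinv_svd_mx.
- rewrite cb /mpinv_coord /svd_P /svd_H /svd_sigma /=.
  by congr (_, _, _); apply/matrixP => i j; rewrite !mxE /= rev_ordK.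
- move=> i; have [a fa] := fs (rev_ord i); exists (rev_ord a).
  by rewrite /svd_sigma !mxE /= !rev_ordK; congr (_^-1).
Qed.

End moore_penrose.

(** * Calculus of matrix-valued maps *)

Section matrix_calculus.
Context (R : realType).

Lemma continuous_mxP (T : topologicalType) a b (f : T -> 'M[R]_(a, b)) u :
  {for u, continuous f} <-> forall i j, {for u, continuous (fun x => f x i j)}.
Proof.
split=> [cf i j|cf].
  apply: (@continuous_comp _ _ _ f (fun X : 'M[R]_(a, b) => X i j) u cf).
  exact: coord_continuous.
move=> A [P fP sPA]; apply: (@filterS _ (nbhs u) _
  [set x | forall i j, P i j (f x i j)]); first by move=> x /sPA.
apply: filter_forall => i; apply: filter_forall => j.
exact: (cf i j _ (fP i j)).
Qed.

Lemma near_continuous (T U : topologicalType) (f g : T -> U) u :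
  (\near u, f u = g u) -> {for u, continuous f} -> {for u, continuous g}.
Proof.
move=> fg; rewrite /prop_for /continuous_at => cf; rewrite -(nbhs_singleton fg).
exact: cvg_trans (near_eq_cvg fg) cf.
Qed.

Lemma continuous_colsub (T : topologicalType) a b c (f : T -> 'M[R]_(a, b))
    (g : 'I_c -> 'I_b) u :
  {for u, continuous f} -> {for u, continuous (fun x => colsub g (f x))}.
Proof.
move=> /continuous_mxP cf; apply/continuous_mxP => i j.
apply: (near_continuous (f := fun x => f x i (g j))); last exact: cf.
by apply: nearW => x; rewrite mxE.
Qed.

(** With [d := svd_dim N m k], [C1_mx] below is convertible to [C1_on]; a free [d]
    makes it possible to identify the parameter spaces of the charts for [N x m] and
    [m x N] matrices, whose dimensions are equal only propositionally. *)
Definition C1_fun d (U : set 'rV[R]_d) (f : 'rV[R]_d -> R) :=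
  forall u, U u -> {for u, continuous f} /\
    forall i : 'I_d, derivable f u 'e_i /\ {for u, continuous ('D_'e_i f)}.

Definition C1_mx d a b (U : set 'rV[R]_d) (f : 'rV[R]_d -> 'M[R]_(a, b)) :=
  forall u, U u -> {for u, continuous f} /\
    forall i : 'I_d, derivable f u 'e_i /\ {for u, continuous ('D_'e_i f)}.

Lemma C1_mxP d a b (U : set 'rV[R]_d) (f : 'rV[R]_d -> 'M[R]_(a, b)) :
  open U -> C1_mx U f <-> forall i j, C1_fun U (fun u => f u i j).
Proof.
move=> oU.
have derE v i j : (forall u, U u -> derivable f u v) -> forall u, U u ->
    \near u, 'D_v f u i j = 'D_v (fun x => f x i j) u.
  move=> df u Uu; have : nbhs u U by exact: open_nbhs_nbhs.
  by apply: filterS => x Ux; rewrite derive_mx ?mxE//; exact: df.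
split=> [cf i j u Uu|cf u Uu].
  have [fu dfu] := cf _ Uu; split; first exact: (continuous_mxP _ _).1.
  move=> l; have [dl cl] := dfu l; split; first exact: (derivable_mxP _ _ _).1.
  apply: (near_continuous (f := fun u => 'D_'e_l f u i j)).
    apply: (derE _ i j _ _ Uu) => x Ux.
    by have [_ dfx] := cf _ Ux; have [] := dfx l.
  exact: (continuous_mxP _ _).1.
have df x l : U x -> derivable f x 'e_l.
  by move=> Ux; apply/derivable_mxP => i j; have [_ /(_ l)[]] := cf i j _ Ux.
split.
  by apply/continuous_mxP => i j; have [] := cf i j _ Uu.
move=> l; split; first exact: df.
apply/continuous_mxP => i j.
apply: (near_continuous (f := 'D_'e_l (fun x => f x i j))).
  have := derE 'e_l i j (fun x => @df x l) u Uu.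
  by apply: filterS => x /esym.
by have [_ /(_ l)[]] := cf i j _ Uu.
Qed.

Lemma C1_fun_inv d (U : set 'rV[R]_d) (f : 'rV[R]_d -> R) : open U ->
  (forall u, U u -> f u != 0) -> C1_fun U f -> C1_fun U (fun u => (f u)^-1).
Proof.
move=> oU f0 cf u Uu; have [fu dfu] := cf _ Uu; split.
  by apply: continuousV => //; exact: f0.
move=> i; have [di ci] := dfu i; split; first by apply: derivableV => //; exact: f0.
apply: (near_continuous (f := fun u => - (f u) ^- 2 *: 'D_'e_i f u)).
  have : nbhs u U by exact: open_nbhs_nbhs.
  apply: filterS => x Ux; have [_ /(_ i)[dx _]] := cf _ Ux.
  by rewrite (deriveV (f0 _ Ux) dx).
apply: continuousM; last exact: ci.
apply: continuousN; apply: continuousV.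
  by rewrite expf_neq0// f0.
by apply: (continuous_comp (g := fun x : R => x ^+ 2)) => //; exact: exprn_continuous.
Qed.

(** [partial_coord] along an arbitrary direction, for parameters of any dimension. *)
Definition tangent N m k d (phi : 'rV[R]_d -> svd_coord R N m k) (v u : 'rV[R]_d) :
    svd_coord R N m k :=
  ('D_v (fun x => svd_H (phi x)) u, 'D_v (fun x => svd_sigma (phi x)) u,
   'D_v (fun x => svd_P (phi x)) u).

Lemma derive_colsub d a b c (f : 'rV[R]_d -> 'M[R]_(a, b)) (g : 'I_c -> 'I_b) v u :
  derivable f u v -> 'D_v (fun x => colsub g (f x)) u = colsub g ('D_v f u).
Proof.
move=> df.
have E i j : (fun x => colsub g (f x) i j) = (fun x => f x i (g j)).
  by apply/funext => x; rewrite mxE.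
rewrite derive_mx; last first.
  by apply/derivable_mxP => i j; rewrite E; exact: (derivable_mxP _ _ _).1.
by apply/matrixP => i j; rewrite derive_mx// !mxE E.
Qed.

Lemma tangent_mpinv N m k d (phi : 'rV[R]_d -> svd_coord R N m k) v u :
  derivable (fun x => svd_H (phi x)) u v ->
  derivable (fun x => svd_sigma (phi x)) u v ->
  derivable (fun x => svd_P (phi x)) u v ->
  (forall i, svd_sigma (phi u) ord0 i != 0) ->
  tangent (fun x => mpinv_coord (phi x)) v u =
  (colsub (@rev_ord k) (svd_P (tangent phi v u)),
   \row_i (- svd_sigma (phi u) ord0 (rev_ord i) ^- 2 *
           svd_sigma (tangent phi v u) ord0 (rev_ord i)),
   colsub (@rev_ord k) (svd_H (tangent phi v u))).
Proof.
move=> dH dS dP s0; rewrite /tangent /mpinv_coord /svd_H /svd_P /svd_sigma /=.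
congr (_, _, _); [exact: derive_colsub| |exact: derive_colsub].
have E i j : (fun x => (\row_l (svd_sigma (phi x) ord0 (rev_ord l))^-1) i j) =
    (fun x => (svd_sigma (phi x) ord0 (rev_ord j))^-1).
  by apply/funext => x; rewrite mxE.
have dSij i j := (derivable_mxP _ _ _).1 dS i j.
rewrite derive_mx; last first.
  by apply/derivable_mxP => i j; rewrite E; exact: derivableV.
by apply/matrixP => i j; rewrite !mxE E deriveV// derive_mx// !mxE.
Qed.

(** Differentiating [H^T H = 1] gives [H^T dH + (H^T dH)^T = 0]. *)
Lemma orthonormal_skew d n k (H : 'rV[R]_d -> 'M[R]_(n, k)) v u :
  derivable H u v -> (\near u, (H u)^T *m H u = 1%:M) ->
  forall i j, ((H u)^T *m 'D_v H u) i j = - ((H u)^T *m 'D_v H u) j i.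
Proof.
move=> dH HH i j; have dHij := (derivable_mxP _ _ _).1 dH.
have : 'D_v (\sum_l (fun x => H x l i * H x l j)) u = 0.
  rewrite -(derive_cst ((1%:M : 'M[R]_k) i j) u v); apply: near_eq_derive.
  move: HH; apply: filterS => x Hx; rewrite /cst -Hx mxE fct_sumE.
  by apply: eq_bigr => l _; rewrite mxE.
rewrite derive_sum => [|l]; last exact: derivableM.
move=> H0; apply/eqP; rewrite -addr_eq0 -[X in _ == X]H0; apply/eqP.
rewrite !mxE -big_split/=; apply: eq_bigr => l _.
by rewrite deriveM// derive_mx// !mxE addrC; congr (_ + _); exact: mulrC.
Qed.

End matrix_calculus.

(** * Reversal of the columns of a Stiefel frame *)

Section reversal.

(** Extends the reversal of the first [k] columns, as the completing columns stay in
    place. The default value of [insubd] is never used when [k <= n]. *)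
Definition rev_head n k (i : 'I_n) : 'I_n :=
  insubd i (if (i < k)%N then k - i.+1 else i)%N.

Lemma val_rev_head n k (i : 'I_n) : (k <= n)%N ->
  rev_head k i = (if (i < k)%N then k - i.+1 else i)%N :> nat.
Proof.
by move=> kn; rewrite val_insubd ifT//; case: ifP => // ik; have := ltn_ord i; lia.
Qed.

Lemma rev_head_inj n k : (k <= n)%N -> injective (@rev_head n k).
Proof.
move=> kn i j /(congr1 val) /=; rewrite !val_rev_head// => ij; apply/val_inj => /=.
by move: ij; do 2 case: ifP; lia.
Qed.

(** For [j < k], the form [h_j' dh_i] of the reversed frame has the reversed indices
    in the wrong order. They are exchanged, at the cost of a sign, to get an index of
    the original family. *)
Definition flip n k (p : stiefel_idx n k) : stiefel_idx n k :=
  insubd p (if (val p).2 < k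
            then (insubd (val p).1 (k - (val p).2.+1),
                  insubd (val p).2 (k - (val p).1.+1))
            else (rev_ord (val p).1, (val p).2))%N.

Lemma val_flip n k (p : stiefel_idx n k) : (k <= n)%N ->
  (val (flip p)).1 =
     (k - (if (val p).2 < k then (val p).2 : nat else (val p).1).+1)%N :> nat
  /\ (val (flip p)).2 =
     (if (val p).2 < k then k - (val p).1.+1 else (val p).2 : nat)%N :> nat.
Proof.
case: p => -[i j] /= ij kn; have ik := ltn_ord i; have jn := ltn_ord j.
rewrite /flip /=; case: ifP => jk.
  have Ei : insubd i (k - j.+1)%N = (k - j.+1)%N :> nat.
    by rewrite val_insubd ifT//; lia.
  have Ej : insubd j (k - i.+1)%N = (k - i.+1)%N :> nat.
    by rewrite val_insubd ifT//; lia.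
  by rewrite val_insubd /= Ei Ej ifT /= ?Ei ?Ej; [|lia].
by rewrite val_insubd /= ifT//=; lia.
Qed.

Lemma flipK n k : (k <= n)%N -> involutive (@flip n k).
Proof.
move=> kn p; have [f1 f2] := val_flip p kn; have [g1 g2] := val_flip (flip p) kn.
apply/val_inj/eqP; rewrite -pair_eqE /= -!val_eqE /= g1 g2 f1 f2 {f1 f2 g1 g2}.
case: p => -[i j] /= ij; have ik := ltn_ord i; have jn := ltn_ord j.
case: (ltnP j k) => jk; last by rewrite ltnNge jk /= eqxx andbT; apply/eqP; lia.
have -> : (k - i.+1 < k)%N by lia.
by apply/andP; split; apply/eqP; lia.
Qed.

(** [N] and [m] are exchanged because [H1] of the inverse is [P1]. *)
Definition form_flip N m k (w : form_idx m N k) : form_idx N m k :=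
  match w with
  | inl (inl p) => inl (inr (flip p))
  | inl (inr p) => inl (inl (flip p))
  | inr i => inr (rev_ord i)
  end.

Lemma form_flipK N m k : (k <= N)%N -> (k <= m)%N ->
  cancel (@form_flip N m k) (@form_flip m N k).
Proof. by move=> kN km [[p|p]|i] /=; rewrite ?flipK// rev_ordK. Qed.

Lemma svd_dimC N m k : svd_dim m N k = svd_dim N m k.
Proof. by rewrite /svd_dim /form_idx !card_sum; congr (_ + _)%N; exact: addnC. Qed.

Context (R : realType).

Lemma completes_rev n k (H : 'M[R]_(n, k)) Q : (k <= n)%N -> completes H Q ->
  completes (colsub (@rev_ord k) H) (colsub (rev_head k) Q).
Proof.
move=> kn [QQ HQ]; split.
  apply/matrixP => i j; transitivity ((Q^T *m Q) (rev_head k i) (rev_head k j)).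
    by rewrite !mxE; apply: eq_bigr => l _; rewrite !mxE.
  by rewrite QQ !mxE (inj_eq (rev_head_inj kn)).
move=> i a b ab; rewrite !mxE; apply: HQ => /=.
by rewrite val_rev_head// -ab ltn_ord.
Qed.

Lemma completes_mul n k (H M : 'M[R]_(n, k)) Q (a : 'I_k) (b : 'I_n) j :
  completes H Q -> a = b :> nat -> (Q^T *m M) b j = (H^T *m M) a j.
Proof.
move=> [_ HQ] ab; rewrite !mxE; apply: eq_bigr => l _.
by rewrite !mxE (HQ _ _ _ ab).
Qed.

(** The forms with [j >= k] pair a completing vector, which stays in place, with a
    column of the frame, so skew-symmetry, and the sign, concern only [j < k]. *)
Lemma coframe_rev n k (H M : 'M[R]_(n, k)) Q (p : stiefel_idx n k) :
  (k <= n)%N -> completes H Q ->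
  (forall i j, (H^T *m M) i j = - (H^T *m M) j i) ->
  ((colsub (rev_head k) Q)^T *m colsub (@rev_ord k) M) (val p).2 (val p).1 =
  (-1) ^+ ((val p).2 < k)%N * (Q^T *m M) (val (flip p)).2 (val (flip p)).1.
Proof.
move=> kn HQ skew; have [f1 f2] := val_flip p kn.
transitivity ((Q^T *m M) (rev_head k (val p).2) (rev_ord (val p).1)).
  by rewrite !mxE; apply: eq_bigr => l _; rewrite !mxE.
have rh := val_rev_head (val p).2 kn.
move: f1 f2 rh; case: ifP => jk f1 f2 rh.
  have r2 : rev_head k (val p).2 = rev_ord (Ordinal jk) :> nat by rewrite rh.
  rewrite (completes_mul _ _ HQ (esym r2)) skew expr1 mulN1r.
  have r1 : rev_ord (val p).1 = (val (flip p)).2 :> nat by rewrite f2.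
  rewrite -(completes_mul _ _ HQ r1); congr (- _); congr (_ _ _); apply/val_inj => /=.
  by rewrite f1.
rewrite expr0 mul1r; congr (_ _ _); apply/val_inj => /=; first by rewrite rh f2.
by rewrite f1.
Qed.

Lemma normr_det_row_perm d d' (e : d' = d) (s : 'I_d' -> 'I_d) (x : 'I_d' -> R)
    (M : 'M[R]_d) (M' : 'M[R]_d') :
  injective s -> (forall a b, M' a b = x a * M (s a) (cast_ord e b)) ->
  `|\det M'| = `|\prod_a x a| * `|\det M|.
Proof.
subst d => sI M'E.
have -> : M' = diag_mx (\row_a x a) *m row_perm (perm sI) M.
  apply/matrixP => a b; rewrite mul_diag_mx !mxE permE M'E.
  by congr (_ * M _ _); apply/val_inj.
rewrite det_mulmx det_diag row_permE det_mulmx det_perm !normrM normrX normrN1.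
rewrite expr1n mul1r; congr (`|_| * _).
by apply: eq_bigr => a _; rewrite mxE.
Qed.

(** Stated for variables [d] and [d'], so that the equation can be eliminated. *)
Lemma integral_cast d d' (e : d' = d) (A : set 'rV[R]_d) (F : 'rV[R]_d -> \bar R) :
  (\int[lebesgue_rV R d']_(v in castmx (erefl, e) @^-1` A) F (castmx (erefl, e) v) =
   \int[lebesgue_rV R d]_(u in A) F u)%E.
Proof.
subst d.
by rewrite (_ : castmx _ = id)//; apply/funext => v; rewrite castmx_id.
Qed.

End reversal.

(** * The weight of the measure *)

Section weight.
Context (R : realType).

(** The density in the theorem. *)
Definition mpinv_jac N m k (s : 'rV[R]_k) : R :=
  \prod_(i < k) s ord0 i ^- (2 * (N + m - k)).

(** Each index lies in [k - 1] pairs. *)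
Lemma prod_pairs k (a : 'I_k -> R) :
  \prod_(i < k) \prod_(j < k | (i < j)%N) (a i * a j) = \prod_i a i ^+ k.-1.
Proof.
transitivity (\prod_(i < k) ((\prod_(j < k | (i < j)%N) a i) *
    \prod_(j < k | (i < j)%N) a j)).
  by apply: eq_bigr => i _; rewrite big_split.
rewrite big_split /= [X in _ * X](exchange_big_dep predT)//= -big_split /=.
apply: eq_bigr => i _.
have <- : #|predC1 i| = k.-1 by rewrite cardC1 card_ord.
rewrite -prodr_const [RHS](bigID (fun j : 'I_k => (i < j)%N)) /=.
congr (_ * _); apply: eq_bigl => j; rewrite !inE -val_eqE /=; lia.
Qed.

Lemma vandermonde_rev_inv k (s : 'I_k -> R) : (forall i, s i != 0) ->
  \prod_(i < k) \prod_(j < k | (i < j)%N)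
     ((s (rev_ord i))^-1 ^+ 2 - (s (rev_ord j))^-1 ^+ 2) =
  \prod_(i < k) \prod_(j < k | (i < j)%N) (s i ^+ 2 - s j ^+ 2) *
  \prod_(i < k) s i ^- (2 * k.-1).
Proof.
move=> s0; rewrite (reindex_inj rev_ord_inj) /=.
under eq_bigr => i _.
  rewrite (reindex_inj rev_ord_inj) /=.
  under eq_bigl => j do rewrite ltn_rev.
  under eq_bigr => j _ do rewrite !rev_ordK.
  over.
rewrite /= (exchange_big_dep predT)//=.
under [X in _ = _ * X]eq_bigr do rewrite exprM -exprVn.
rewrite -prod_pairs -big_split /=; apply: eq_bigr => i _.
rewrite -big_split /=; apply: eq_bigr => j _.
by field; rewrite !s0.
Qed.

Lemma svd_weight_mpinv N m k (s : 'rV[R]_k) : (k <= N)%N -> (k <= m)%N ->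
  (forall i, s ord0 i != 0) ->
  svd_weight m N (\row_i (s ord0 (rev_ord i))^-1) * \prod_i s ord0 i ^- 2 =
  mpinv_jac N m s * svd_weight N m s.
Proof.
move=> kN km s0; rewrite /svd_weight /mpinv_jac.
under [X in _ * X * _ * _]eq_bigr do rewrite mxE.
under [X in _ * _ * X * _]eq_bigr => i _ do under eq_bigr => j _ do rewrite !mxE.
rewrite (vandermonde_rev_inv s0) (reindex_inj rev_ord_inj) /=.
under [X in _ * X * _ * _]eq_bigr do rewrite rev_ordK.
set V := (X in _ * (X * _) * _).
have -> : \prod_i s ord0 i ^- (2 * (N + m - k)) =
  (\prod_i (s ord0 i)^-1 ^+ (m + N - 2 * k)) ^+ 2 * \prod_i s ord0 i ^- (2 * k.-1) *
  \prod_i s ord0 i ^- 2.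
  rewrite -prodrXl -!big_split /=; apply: eq_bigr => i _.
  by rewrite -!exprVn -!exprM -!exprD; congr (_ ^+ _); have := ltn_ord i; lia.
have AB : \prod_i (s ord0 i)^-1 ^+ (m + N - 2 * k) *
          \prod_i s ord0 i ^+ (N + m - 2 * k) = 1.
  rewrite -big_split big1//= => i _.
  by rewrite addnC -exprMn mulVf ?expr1n.
move: AB; set A := \prod_i _ ^+ (m + N - _); set B := \prod_i _ ^+ (N + m - _) => AB.
set C := \prod_i _; set D := \prod_i _.
(* the two sides are equal up to the factor A * B = 1 *)
transitivity (2 ^- k * A * (V * C) * D * (A * B)); first by rewrite AB mulr1.
by rewrite -/V; ring.
Qed.

End weight.

(** * The image of a chart *)

Section chart_mpinv.
Context (R : realType).

(** The signs of the exchanged Stiefel forms, and the derivative of the inverse. *)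
Definition flip_scale N m k (s : 'rV[R]_k) (w : form_idx m N k) : R :=
  match w with
  | inl (inl p) => (-1) ^+ ((val p).2 < k)%N
  | inl (inr p) => (-1) ^+ ((val p).2 < k)%N
  | inr i => - s ord0 (rev_ord i) ^- 2
  end.

Lemma normr_prod_flip_scale N m k (s : 'rV[R]_k) :
  `|\prod_(w : form_idx m N k) flip_scale s w| = \prod_i s ord0 i ^- 2.
Proof.
rewrite normr_prod !big_sumType /= [X in X * _ * _]big1 => [|p _]; last first.
  by rewrite normrX normrN1 expr1n.
rewrite [X in _ * X * _]big1 => [|p _]; last by rewrite normrX normrN1 expr1n.
rewrite !mul1r [RHS](reindex_inj rev_ord_inj); apply: eq_bigr => i _ /=.
by rewrite normrN normfV ger0_norm// sqr_ge0.
Qed.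

(** Each form of the inverse is a multiple of a single form of the original point, so
    the pullbacks differ by a signed permutation and a scaling of the rows. *)
Lemma coframe_mpinv N m k d (phi : 'rV[R]_d -> svd_coord R N m k) Q1 Q2 v u w :
  (k <= N)%N -> (k <= m)%N ->
  derivable (fun x => svd_H (phi x)) u v ->
  derivable (fun x => svd_sigma (phi x)) u v ->
  derivable (fun x => svd_P (phi x)) u v ->
  (\near u, svd_space (phi u)) ->
  completes (svd_H (phi u)) Q1 -> completes (svd_P (phi u)) Q2 ->
  coframe (colsub (rev_head k) Q2) (colsub (rev_head k) Q1)
    (tangent (fun x => mpinv_coord (phi x)) v u) w =
  flip_scale (svd_sigma (phi u)) w * coframe Q1 Q2 (tangent phi v u) (form_flip w).
Proof.
move=> kN km dH dS dP S HQ PQ.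
have [_ _ s0 _] := nbhs_singleton S.
rewrite tangent_mpinv//; last by move=> i; rewrite gt_eqF.
case: w => [[p|p]|i] /=.
- apply: (coframe_rev _ km PQ); apply: orthonormal_skew => //.
  by move: S; apply: filterS => x [].
- apply: (coframe_rev _ kN HQ); apply: orthonormal_skew => //.
  by move: S; apply: filterS => x [].
- by rewrite /svd_sigma /= mxE.
Qed.

Lemma tangent_cast N m k d d' (e : d' = d) (phi : 'rV[R]_d -> svd_coord R N m k) b v :
  tangent (fun x => phi (castmx (erefl, e) x)) 'e_b v =
  tangent phi 'e_(cast_ord e b) (castmx (erefl, e) v).
Proof.
subst d; rewrite cast_ord_id castmx_id.
by rewrite (_ : (fun x => phi _) = phi)//; apply/funext => x; rewrite castmx_id.
Qed.

Lemma continuous_cast d d' (e : d' = d) :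
  continuous (castmx (erefl, e) : 'rV[R]_d' -> 'rV[R]_d).
Proof.
by subst d; move=> v A; rewrite castmx_id; apply: filterS => x; rewrite /= castmx_id.
Qed.

Lemma C1_fun_cast d d' (e : d' = d) (U : set 'rV[R]_d) f : C1_fun U f ->
  C1_fun (castmx (erefl, e) @^-1` U) (fun v => f (castmx (erefl, e) v)).
Proof.
subst d; have -> : castmx (erefl, erefl) = id :> ('rV[R]_d' -> 'rV[R]_d').
  by apply/funext => v; rewrite castmx_id.
by [].
Qed.

Local Notation recast N m k := (castmx (erefl 1, svd_dimC N m k)).

Definition chart_mpinv N m k (C : svd_chart R N m k) : svd_chart R m N k :=
  SvdChart (recast N m k @^-1` chart_dom C)
    (fun v => mpinv_coord (chart_map C (recast N m k v)))
    (fun v => colsub (rev_head k) (chart_Q2 C (recast N m k v)))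
    (fun v => colsub (rev_head k) (chart_Q1 C (recast N m k v))).

Section fixed_chart.
Variables (N m k : nat) (C : svd_chart R N m k).
Hypotheses (kN : (k <= N)%N) (km : (k <= m)%N) (hC : is_svd_chart C).

Lemma near_svd_space u : chart_dom C u -> \near u, svd_space (chart_map C u).
Proof.
have [oU sp _ _ _] := hC; move=> Uu.
have : nbhs u (chart_dom C) by exact: open_nbhs_nbhs.
by apply: filterS => x /sp[].
Qed.

Lemma form_pullback_mpinv v : chart_dom C (recast N m k v) ->
  `|form_pullback (chart_mpinv C) v| =
  \prod_i svd_sigma (chart_map C (recast N m k v)) ord0 i ^- 2 *
  `|form_pullback C (recast N m k v)|.
Proof.
move=> Uv; set u := castmx _ v in Uv *.
have [_ sp _ [cH cD cP] _] := hC.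
have [_ HQ PQ] := sp _ Uv.
pose s (a : 'I_(svd_dim m N k)) := enum_rank (form_flip (enum_val a)).
rewrite /form_pullback (@normr_det_row_perm _ _ _ (svd_dimC N m k) s
  (fun a => flip_scale (svd_sigma (chart_map C u)) (enum_val a))
  (\matrix_(a < _, b < _) coframe (chart_Q1 C u) (chart_Q2 C u)
      (partial_coord (chart_map C) b u) (enum_val a))); last 2 first.
- move=> a b /enum_rank_inj ab; apply: enum_val_inj.
  exact: (can_inj (form_flipK kN km)) ab.
- move=> a b; rewrite !mxE enum_rankK.
  rewrite -[partial_coord _ _ u]/(tangent (chart_map C) _ u).
  rewrite -[partial_coord _ _ v]/(tangent
    (fun x => mpinv_coord (chart_map C (recast N m k x))) _ v).
  rewrite (tangent_cast _ (fun x => mpinv_coord (chart_map C x))).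
  apply: coframe_mpinv => //; last exact: near_svd_space.
  + by have [_ /(_ (cast_ord (svd_dimC N m k) b))[]] := cH _ Uv.
  + by have [_ /(_ (cast_ord (svd_dimC N m k) b))[]] := cD _ Uv.
  + by have [_ /(_ (cast_ord (svd_dimC N m k) b))[]] := cP _ Uv.
congr (_ * _); rewrite -(normr_prod_flip_scale N m); congr `|_|.
rewrite [RHS](reindex (fun a : 'I_(svd_dim m N k) => enum_val a)) //=.
exact/onW_bij/enum_val_bij.
Qed.

Lemma is_svd_chart_mpinv : is_svd_chart (chart_mpinv C).
Proof.
have [oU sp inj [cH cD cP] cQ] := hC.
have oU' : open (chart_dom (chart_mpinv C)).
  by apply: open_comp => // v _; exact: continuous_cast.
split; first exact: oU'.
- move=> v Uv; have [S HQ PQ] := sp _ Uv; split.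
  + exact: svd_space_mpinv_coord.
  + exact: (completes_rev km PQ).
  + exact: (completes_rev kN HQ).
- move=> v w Uv Uw /(can_inj (@mpinv_coordK _ _ _ _)) vw.
  exact: (can_inj (castmxK _ _)) (inj _ _ Uv Uw vw).
- split.
  + apply/(C1_mxP _ oU') => i j.
    have := C1_fun_cast (e := svd_dimC N m k) ((C1_mxP _ oU).1 cP i (rev_ord j)).
    by congr (C1_fun _ _); apply/funext => v; rewrite /svd_H mxE.
  + apply/(C1_mxP _ oU') => i j.
    have := C1_fun_cast (e := svd_dimC N m k)
      (C1_fun_inv oU _ ((C1_mxP _ oU).1 cD ord0 (rev_ord j))).
    have -> : (fun v => svd_sigma (chart_map (chart_mpinv C) v) i j) =
        (fun v => (svd_sigma (chart_map C (recast N m k v)) ord0 (rev_ord j))^-1).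
      by apply/funext => v; rewrite /svd_sigma mxE.
    by apply => u /sp[[_ _ s0 _] _ _]; rewrite gt_eqF.
  + apply/(C1_mxP _ oU') => i j.
    have := C1_fun_cast (e := svd_dimC N m k) ((C1_mxP _ oU).1 cH i (rev_ord j)).
    by congr (C1_fun _ _); apply/funext => v; rewrite /svd_P mxE.
- move=> v Uv; have [c1 c2 F0] := cQ _ Uv; split.
  + apply: continuous_colsub; apply: continuous_comp; [exact: continuous_cast|exact: c2].
  + apply: continuous_colsub; apply: continuous_comp; [exact: continuous_cast|exact: c1].
  + rewrite -normr_gt0 form_pullback_mpinv// mulr_gt0 ?normr_gt0//.
    have [[_ _ s0 _] _ _] := sp _ Uv.
    by apply: prodr_gt0 => i _; rewrite invr_gt0 exprn_gt0.
Qed.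

Lemma chart_density_mpinv v : chart_dom C (recast N m k v) ->
  chart_density (chart_mpinv C) v =
  mpinv_jac N m (svd_sigma (chart_map C (recast N m k v))) *
  chart_density C (recast N m k v).
Proof.
move=> Uv; have [_ sp _ _ _] := hC; have [[_ _ s0 _] _ _] := sp _ Uv.
set s := svd_sigma _ in s0 *.
have sN0 i : s ord0 i != 0 by rewrite gt_eqF.
have J0 : 0 <= mpinv_jac N m s.
  by apply: prodr_ge0 => i _; rewrite invr_ge0 exprn_ge0// ltW.
rewrite /chart_density normrM form_pullback_mpinv// -/s.
have P0 : 0 <= \prod_i s ord0 i ^- 2.
  by apply: prodr_ge0 => i _; rewrite invr_ge0 exprn_ge0// ltW.
rewrite mulrA -{1}(ger0_norm P0) -normrM.
rewrite (_ : svd_sigma _ = \row_i (s ord0 (rev_ord i))^-1)//.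
by rewrite svd_weight_mpinv// (normrM (mpinv_jac _ _ _)) (ger0_norm J0) -mulrA -normrM.
Qed.

End fixed_chart.
End chart_mpinv.

(** * Measurability *)

Section measure.
Context (R : realType).

Lemma measurable_fun_invr d (T : measurableType d) (D : set T) (f : T -> R) :
  measurable_fun D f -> measurable_fun D (fun x => (f x)^-1).
Proof.
move=> mf; (* powR inverts nonnegative numbers only; this formula holds at 0 as well *)
apply: (eq_measurable_fun (fun x => f x * (f x ^+ 2) `^ (-1))).
  move=> x _; rewrite powR_inv1 ?sqr_ge0//.
  by have [->|f0] := eqVneq (f x) 0; [rewrite mul0r invr0|field].
apply: measurable_funM => //.
exact: (measurableT_comp (measurable_powR (-1)) (measurable_funX 2 mf)).
Qed.

Lemma measurable_svd_H N m k : measurable_fun setT (@svd_H R N m k).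
Proof. exact: measurableT_comp measurable_fst measurable_fst. Qed.

Lemma measurable_svd_sigma N m k : measurable_fun setT (@svd_sigma R N m k).
Proof. exact: measurableT_comp measurable_snd measurable_fst. Qed.

Lemma measurable_svd_P N m k : measurable_fun setT (@svd_P R N m k).
Proof. exact: measurable_snd. Qed.

Lemma measurable_sigma_entry N m k i :
  measurable_fun setT (fun c : svd_coord R N m k => svd_sigma c ord0 i).
Proof. exact: measurableT_comp (measurable_entry ord0 i) (@measurable_svd_sigma N m k). Qed.

Lemma measurable_colsub d (T : measurableType d) (D : set T) a b c
    (f : T -> 'M[R]_(a, b)) (g : 'I_c -> 'I_b) : measurable D ->
  measurable_fun D f -> measurable_fun D (fun x => colsub g (f x)).
Proof.
move=> mD mf; apply: measurable_mxP => // i j.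
apply: (eq_measurable_fun (fun x => f x i (g j))) => [x _|]; first by rewrite mxE.
exact: measurableT_comp (measurable_entry i (g j)) mf.
Qed.

Lemma measurable_mpinv_coord N m k : measurable_fun setT (@mpinv_coord R N m k).
Proof.
apply: measurable_pairD; first apply: measurable_pairD.
- exact: measurable_colsub (@measurable_svd_P N m k).
- apply: measurable_mxP => // i j.
  apply: (eq_measurable_fun (fun c => (svd_sigma c ord0 (rev_ord j))^-1)) => [x _|].
    by rewrite mxE.
  by apply: measurable_fun_invr; exact: measurable_sigma_entry.
- exact: measurable_colsub (@measurable_svd_H N m k).
Qed.

Lemma measurable_svd_mx N m k : measurable_fun setT (@svd_mx R N m k).
Proof.
apply: measurable_mulmx => //; last first.
  by apply: measurable_trmx => //; exact: measurable_svd_P.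
apply: measurable_mulmx => //; first exact: measurable_svd_H.
apply: measurable_mxP => // i j.
apply: (eq_measurable_fun (fun c => svd_sigma c ord0 i *+ (i == j))) => [c _|].
  by rewrite mxE.
by case: (i == j); [exact: measurable_sigma_entry|exact: measurable_cst].
Qed.

Lemma measurable_orthonormal d (T : measurableType d) n k (f : T -> 'M[R]_(n, k)) :
  measurable_fun setT f -> measurable [set x | (f x)^T *m f x = 1%:M].
Proof.
move=> mf; have mg : measurable_fun setT (fun x => (f x)^T *m f x).
  by apply: measurable_mulmx => //; exact: measurable_trmx.
rewrite (_ : mkset _ = \bigcap_(i in setT) \bigcap_(j in setT)
    ((fun x => ((f x)^T *m f x) i j) @^-1` [set (1%:M : 'M[R]_k) i j])).
  apply: fin_bigcap_measurable => // i _; apply: fin_bigcap_measurable => // j _.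
  rewrite -[X in measurable X]setTI.
  exact: (measurableT_comp (measurable_entry i j) mg) (measurable_set1 _).
apply/seteqP; split=> [x /= fx i _ j _|x fx]; first by rewrite /= fx.
by apply/matrixP => i j; exact: (fx i Logic.I j Logic.I).
Qed.

Lemma measurable_svd_space N m k : measurable (@svd_space R N m k).
Proof.
rewrite (_ : @svd_space R N m k =
  [set c | (svd_H c)^T *m svd_H c = 1%:M] `&`
  [set c | (svd_P c)^T *m svd_P c = 1%:M] `&`
  (\bigcap_(i in setT) [set c | 0 < svd_sigma c ord0 i]) `&`
  (\bigcap_(i in [set: 'I_k]) \bigcap_(j in [set j : 'I_k | (i < j)%N])
     [set c | svd_sigma c ord0 j < svd_sigma c ord0 i])); last first.
  apply/seteqP; split=> [c [HH PP s0 sd]|c [[[HH PP] s0] sd]].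
    split; first split; first by split.
      by move=> i _; exact: s0.
    by move=> i _ j; exact: sd.
  by split=> // [i|i j ij]; [exact: s0|exact: sd].
have mlt (f g : svd_coord R N m k -> R) : measurable_fun setT f ->
    measurable_fun setT g -> measurable [set c | f c < g c].
  move=> mf mg; rewrite -[X in measurable X]setTI.
  exact: (measurable_fun_ltr mf mg measurableT (Y := [set true])).
apply: measurableI; first apply: measurableI; first apply: measurableI.
- by apply: measurable_orthonormal; exact: measurable_svd_H.
- by apply: measurable_orthonormal; exact: measurable_svd_P.
- apply: fin_bigcap_measurable => // i _; apply: mlt => //.
  exact: measurable_sigma_entry.
- apply: fin_bigcap_measurable => // i _; apply: fin_bigcap_measurable => [|j _].
    exact: finite_finset.
  by apply: mlt; exact: measurable_sigma_entry.
Qed.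

Lemma measurable_mpinv_jac N m k :
  measurable_fun setT (fun c : svd_coord R N m k => mpinv_jac N m (svd_sigma c)).
Proof.
apply: measurable_prod => i _; apply: measurable_fun_invr; apply: measurable_funX.
exact: measurable_sigma_entry.
Qed.

Lemma measurable_preimage_mpinv N m k (B : set (svd_coord R m N k)) :
  measurable B -> measurable (@mpinv_coord R N m k @^-1` B).
Proof.
by move=> mB; rewrite -[X in measurable X]setTI; exact: measurable_mpinv_coord.
Qed.
End measure.

(** * The image of the measure *)

Section measure_mpinv.
Context (R : realType) (k : nat).

Lemma svd_premeasure_setI N m (A B : set (svd_coord R N m k)) :
  measurable A -> measurable B ->
  (svd_premeasure (A `&` B) <= svd_premeasure A)%E.
Proof.
move=> mA mB; apply: le_trans (svd_premeasure_split mA mB).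
by apply: leeDl; exact: svd_premeasure_ge0.
Qed.

(** The empty chart covers the part of [A] in [svd_space]. *)
Lemma svd_premeasure_out N m (A : set (svd_coord R N m k)) :
  A `&` @svd_space R N m k = set0 -> svd_premeasure A = 0%E.
Proof.
move=> AS; apply/eqP; rewrite eq_le svd_premeasure_ge0 andbT.
apply: ereal_inf_lbound; exists (SvdChart set0 (fun=> point) (fun=> point) (fun=> point)).
split; [|by rewrite AS; exact: sub0set|by rewrite set0I integral_set0].
by split; [exact: open0|move=> ? []|move=> ? ? []|split=> ? []|move=> ? []].
Qed.

Lemma svd_measure_setI_space N m (E : set (svd_coord R N m k)) :
  measurable E -> svd_measure (@svd_space R N m k `&` E) = svd_measure E.
Proof.
move=> mE; have mS := @measurable_svd_space R N m k.
have -> : svd_measure E = (svd_measure (E `&` @svd_space R N m k) +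
    svd_measure (E `&` ~` @svd_space R N m k))%E.
  rewrite -measureU//; first by rewrite -setIUr setUv setIT.
  - exact: measurableI.
  - by apply: measurableI => //; exact: measurableC.
  - by apply/seteqP; split=> // x [[_ ?] [_ ?]].
rewrite [X in (_ + X)%E](_ : _ = 0%E) ?adde0 ?(setIC E)//.
apply/eqP; rewrite eq_le outer_measure_ge0 andbT.
apply: ereal_inf_lbound; exists (fun=> ~` @svd_space R N m k `&` E).
  split=> [_|x ?]; last by exists 0%N.
  by apply: measurableI => //; exact: measurableC.
apply: eseries0 => i _ _; apply: svd_premeasure_out.
by rewrite setIAC setICl set0I.
Qed.

Section inequality.
Variables (N m : nat) (b : R) (B : set (svd_coord R N m k)).
Hypotheses (kN : (k <= N)%N) (km : (k <= m)%N) (b0 : 0 < b) (mB : measurable B).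
Hypothesis jb : forall c, B c -> svd_space c -> mpinv_jac N m (svd_sigma c) <= b.

(** A chart [C] that covers [A] gives the chart [chart_mpinv C], which covers the
    inverses of the points of [A], and whose density is at most [b] times that of [C]
    there. *)
Lemma svd_premeasure_mpinv_le (A : set (svd_coord R N m k)) :
  measurable A -> A `<=` B ->
  (svd_premeasure (@mpinv_coord R m N k @^-1` A) <= b%:E * svd_premeasure A)%E.
Proof.
move=> mA AB; rewrite -lee_pdivrMl//; apply: le_ereal_inf_tmp => _ [C [hC AC ->]].
rewrite lee_pdivrMl//; have [oU sp inj _ _] := hC.
have mU : measurable (chart_dom C) by exact: open_measurable_mx.
have mD : measurable (chart_dom C `&` chart_map C @^-1` A).
  exact: (measurable_chart_map hC).
have mdens : measurable_fun (chart_dom C `&` chart_map C @^-1` A) (chart_density C).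
  by apply: measurable_funS (measurable_chart_density hC) => //; exact: subIsetl.
apply: (@le_trans _ _
  (\int[lebesgue_rV R _]_(v in chart_dom (chart_mpinv C) `&`
     chart_map (chart_mpinv C) @^-1` (@mpinv_coord R m N k @^-1` A))
     (chart_density (chart_mpinv C) v)%:E)%E).
  apply: ereal_inf_lbound; exists (chart_mpinv C); split; [|move=> c [Ac Sc]|by []].
    exact: is_svd_chart_mpinv.
  have [u Uu uc] : (chart_map C @` chart_dom C) (mpinv_coord c).
    by apply: AC; split => //; exact: svd_space_mpinv_coord.
  exists (castmx (erefl, esym (svd_dimC N m k)) u).
    by rewrite /= castmxKV.
  by rewrite /= castmxKV uc mpinv_coordK.
rewrite (eq_integral (fun v => (mpinv_jac N m (svd_sigma (chart_map C
      (castmx (erefl, svd_dimC N m k) v))) *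
    chart_density C (castmx (erefl, svd_dimC N m k) v))%:E)); last first.
  by move=> v /set_mem[Uv _]; rewrite chart_density_mpinv.
rewrite [X in (integral _ X _ <= _)%E](_ : _ = castmx (erefl, svd_dimC N m k) @^-1`
  (chart_dom C `&` chart_map C @^-1` A)); last first.
  by apply/seteqP; split=> v [Uv]; rewrite /= mpinv_coordK.
rewrite (integral_cast (svd_dimC N m k) _ (fun u => (mpinv_jac N m (svd_sigma
  (chart_map C u)) * chart_density C u)%:E)).
have d0 u : (0 <= (chart_density C u)%:E)%E by rewrite lee_fin normr_ge0.
rewrite -ge0_integralZl_EFin//; last 2 first.
- exact/measurable_EFinP.
- exact: ltW.
apply: ge0_le_integral => //.
- move=> u [Uu _]; rewrite lee_fin mulr_ge0 ?normr_ge0//.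
  have [[_ _ s0 _] _ _] := sp _ Uu.
  by apply: prodr_ge0 => i _; rewrite invr_ge0 exprn_ge0// ltW.
- apply/measurable_EFinP; apply: measurable_funM => //.
  apply: (measurableT_comp (@measurable_mpinv_jac R N m k)).
  by apply: measurable_funS (measurable_chart_map hC) => //; exact: subIsetl.
- by apply/measurable_EFinP; apply: measurable_funM.
- move=> u [Uu Au]; rewrite -EFinM lee_fin ler_wpM2r ?normr_ge0//.
  by apply: jb; [exact: AB|have [] := sp _ Uu].
Qed.

(** Covers of [B] are cut down to [B], where the bound on the factor holds. *)
Lemma svd_measure_mpinv_le :
  (svd_measure (@mpinv_coord R m N k @^-1` B) <= b%:E * svd_measure B)%E.
Proof.
rewrite -lee_pdivrMl//; apply: le_ereal_inf_tmp => _ [A [mA BA] <-].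
rewrite lee_pdivrMl// -nneseriesZl => [|i _]; last exact: svd_premeasure_ge0.
have mAB i : measurable (A i `&` B) by exact: measurableI.
apply: (@le_trans _ _
  (\sum_(i <oo) svd_premeasure (@mpinv_coord R m N k @^-1` (A i `&` B)))%E).
  apply: ereal_inf_lbound; exists (fun i => @mpinv_coord R m N k @^-1` (A i `&` B)) => //.
  split=> [i|c Bc]; first exact: measurable_preimage_mpinv.
  by have [i _ Ai] := BA _ Bc; exists i.
apply: lee_nneseries => i *; first exact: svd_premeasure_ge0.
apply: le_trans (svd_premeasure_mpinv_le (mAB i) _) _; first exact: subIsetr.
by rewrite lee_pmul2l ?lte_fin//; exact: svd_premeasure_setI.
Qed.

End inequality.

Lemma mpinv_jacV N m (c : svd_coord R N m k) :
  mpinv_jac m N (svd_sigma (mpinv_coord c)) = (mpinv_jac N m (svd_sigma c))^-1.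
Proof.
rewrite /mpinv_jac -prodfV (reindex_inj rev_ord_inj); apply: eq_bigr => i _ /=.
by rewrite /svd_sigma mxE rev_ordK invrK exprVn invrK addnC.
Qed.

(** The upper bound on the image measure [nu] is [svd_measure_mpinv_le]. The lower
    bound is the same inequality for [m x N] matrices, since [mpinv_coord] is an
    involution and the factor at [mpinv_coord c] is the inverse of the factor at [c]. *)
Lemma svd_measure_mpinv N m (E : set (svd_coord R m N k)) :
  (k <= N)%N -> (k <= m)%N -> measurable E ->
  svd_measure E = (\int[@svd_measure R N m k]_(c in
    @svd_space R N m k `&` @mpinv_coord R N m k @^-1` E)
      (mpinv_jac N m (svd_sigma c))%:E)%E.
Proof.
move=> kN km mE; have mS := @measurable_svd_space R N m k.
pose nu := measure_function_pushforward__canonical__measure_function_Measure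
  (@svd_measure R m N k) (@measurable_mpinv_coord R m N k).
have mD : measurable (@svd_space R N m k `&` @mpinv_coord R N m k @^-1` E).
  by apply: measurableI => //; exact: measurable_preimage_mpinv.
rewrite -(@density_of_bounds _ _ _ (@svd_measure R N m k) nu) => //.
- rewrite -svd_measure_setI_space//; congr svd_measure.
  apply/seteqP; split=> c /=; rewrite mpinv_coordK.
    by move=> [Sc Ec]; split => //; exact: svd_space_mpinv_coord.
  by move=> [Sc Ec]; split => //; rewrite -[c]mpinv_coordK; exact: svd_space_mpinv_coord.
- by apply: measurable_funTS; exact: measurable_mpinv_jac.
- move=> c [[_ _ s0 _] _].
  by apply: prodr_gt0 => i _; rewrite invr_gt0 exprn_gt0.
- move=> B b mB BD b0 jb; apply: svd_measure_mpinv_le => // c Bc _; exact: jb.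
- move=> B a mB BD a0 ja.
  rewrite -lee_pdivlMl//.
  have {1}<- : @mpinv_coord R N m k @^-1` (@mpinv_coord R m N k @^-1` B) = B.
    by apply/seteqP; split=> c /=; rewrite mpinv_coordK.
  apply: svd_measure_mpinv_le => //; first by rewrite invr_gt0.
    exact: measurable_preimage_mpinv.
  move=> c Bc _; rewrite -[c]mpinv_coordK mpinv_jacV lef_pV2 ?posrE//; first exact: ja.
  have [[_ _ s0 _] _] := BD _ Bc.
  by apply: prodr_gt0 => i _; rewrite invr_gt0 exprn_gt0.
Qed.

End measure_mpinv.

Theorem theorem3p1 (R : realType) (N m q k : nat) (L : set 'M[R]_(N, m))
    (hq : (q <= minn N m)%N)
    (hk : (L = rank_simple_set q /\ k = q) \/
          (exists l : nat, [/\ (l <= q)%N, L = rank_mult_set q l & k = l])) :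
  [/\ (* P1 D^-1 H1' describes Y = X^+ whenever H1 D P1' describes X *)
      forall (X : 'M[R]_(N, m)) (c : svd_coord R N m k),
        L X -> describes q X c -> describes q (mpinv X) (mpinv_coord c),
      (* (dY) = \prod_i sigma_i^(-2(N+m-k)) (dX), in the coordinates *)
      forall E : set (svd_coord R m N k), measurable E ->
        svd_measure E =
        (\int[@svd_measure R N m k]_(c in
             @svd_space R N m k `&` @mpinv_coord R N m k @^-1` E)
           (\prod_(i < k) svd_sigma c ord0 i ^- (2 * (N + m - k)))%:E)%E &
      (* the same, for the images of both measures on matrices *)
      forall A : set 'M[R]_(m, N), measurable A ->
        svd_measure (@svd_mx R m N k @^-1` A) =
        (\int[@svd_measure R N m k]_(c in
             @svd_space R N m k `&` [set c | A (mpinv (svd_mx c))])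
           (\prod_(i < k) svd_sigma c ord0 i ^- (2 * (N + m - k)))%:E)%E].

Proof.
have kq : (k <= q)%N by case: hk => [[_ ->]//|[l [lq _ ->]]].
have [kN km] : (k <= N)%N /\ (k <= m)%N.
  by move: hq; rewrite leq_min => /andP[qN qm]; split; exact: leq_trans kq _.
split.
- by move=> X c _; exact: describes_mpinv.
- by move=> E mE; exact: svd_measure_mpinv.
- move=> A mA; rewrite (svd_measure_mpinv kN km); last first.
    by rewrite -[X in measurable X]setTI; exact: measurable_svd_mx.
  congr integral; apply/seteqP.
  by split=> c [Sc Ac]; split => //; move: Ac; rewrite /= mpinv_svd_mx//; case: Sc.
Qed.
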